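(* Let $\boldsymbol{X}$ be an upward run chain on the poset $(S, \preceq)$ with transition function $P$. For a finite directed path $a = e\,x_1\,x_2 \cdots x_n$ in the covering graph let $\hat F(a) = P(e,x_1)P(x_1,x_2)\cdots P(x_{n-1},x_n)$ (with $\hat F = 1$ for the path consisting only of $e$). Then: (i) $F(x) = \sum_{a \in \hat S(x)} \hat F(a)$ for all $x \in S$; (ii) $\mathbb{P}_e(T_e > n) = \sum_{a \in \hat S_n} \hat F(a)$ for all $n \in \mathbb{N}$; (iii) $\boldsymbol{X}$ is recurrent if and only if $\sum_{a \in \hat S_n} \hat F(a) \to 0$ as $n \to \infty$; (iv) $\boldsymbol{X}$ is positive recurrent if and only if $\mu(e) := \sum_{x \in S} F(x)$ is finite, and in this case the invariant probability density function $f$ is $f(x) = F(x)/\mu(e)$, $x \in S$.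
   Context: $(S, \preceq)$ is a discrete (countable) partially ordered set with a minimum element $e$, such that for every $x \in S$ every chain (totally ordered subset) in $S$ from $e$ to $x$ is finite. An element $y$ covers $x$ if $y$ is a minimal element of $\{t \in S : t \succ x\}$; $A_x = \{y \in S : y \text{ covers } x\}$. The covering graph is the directed graph on $S$ with an edge $(x,y)$ whenever $y$ covers $x$. $\hat S$ is the set of finite directed paths in the covering graph starting at $e$; $\hat S(x)$ is the set of such paths ending at $x$; $\hat S_n$ is the set of such paths of length $n$ (with $n$ edges). $\mathbb{N} = \{0,1,2,\ldots\}$. An upward run chain on $(S, \preceq)$ is a (time-homogeneous, discrete-time) Markov chain $(X_0, X_1, \ldots)$ on $S$ whose transition function $P$ satisfies $P(x,y) > 0$ if and only if $y \in A_x$ or $y = e$. $\mathbb{P}_e$ denotes probability given $X_0 = e$, and $T_x = \min\{n \ge 1 : X_n = x\}$ (with $\min\emptyset = \infty$). The function $F$ is defined by $F(e) = 1$ and $F(x) = \mathbb{P}_e(T_x < T_e)$ for $x \ne e$. *)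

(* Defs.v *)
From HB Require Import structures.
From mathcomp Require Import all_boot all_order all_algebra.
From mathcomp Require Import all_classical all_reals all_analysis.
Set Implicit Arguments.
Unset Strict Implicit.
Unset Printing Implicit Defensive.
Import Order.TTheory GRing.Theory Num.Theory.
Import numFieldNormedType.Exports.

Local Open Scope classical_set_scope.
Local Open Scope ring_scope.

Section CoveringGraph.
Context {d : Order.disp_t} {S : porderType d}.
Implicit Types (e x y : S) (A C : set S).

Definition chain C := forall a b, C a -> C b -> (a <= b)%O \/ (b <= a)%O.

Definition chain_between C x y :=
  [/\ chain C, C x, C y & forall t, C t -> (x <= t)%O /\ (t <= y)%O].

Record upward_poset e : Prop := {
  poset_countable : countable [set: S];
  poset_min : forall x, (e <= x)%O;
  poset_chain_finite : forall x C, chain_between C e x -> finite_set C }.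

Definition minimal_in A y := A y /\ forall t, A t -> ~ (t < y)%O.

Definition covers y x := minimal_in [set t | (x < t)%O] y.

Definition cover_set x : set S := [set y | covers y x].

Definition cover_edge : rel S := fun x y => `[< cover_set x y >].

(* A path [e x_1 ... x_n] is encoded by the sequence [:: x_1; ...; x_n] of its
   vertices after [e]; [size] is thus its number of edges and [last e] its
   endpoint. *)
Definition paths e : set (seq S) := [set a | path cover_edge e a].

Definition paths_to e x : set (seq S) := [set a | paths e a /\ last e a = x].

Definition paths_len e n : set (seq S) := [set a | paths e a /\ size a = n].

End CoveringGraph.

Definition path_weight {R : realType} {S : Type} (P : S -> S -> R) (e : S)
    (a : seq S) : R :=
  \prod_(i < size a) P (nth e (e :: a) i) (nth e (e :: a) i.+1).

Section MarkovChain.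
Context {R : realType} {S : choiceType}.
Context {dO : measure_display} {Omega : measurableType dO}.
Implicit Types (P : S -> S -> R) (Pr : S -> probability Omega R).
Implicit Types (X : nat -> Omega -> S) (x y : S) (n : nat).

Record transition_function P : Prop := {
  transition_ge0 : forall x y, 0 <= P x y;
  transition_sum1 : forall x, (\esum_(y in [set: S]) (P x y)%:E = 1)%E }.

Definition cond_prob (p : probability Omega R) (A B : set Omega) : R :=
  fine (p (A `&` B)) / fine (p B).

(* The event that the first n + 1 states are h 0, ..., h n. *)
Definition history X n (h : nat -> S) : set Omega :=
  [set w | forall i, (i <= n)%N -> X i w = h i].

(* [Pr x] is the law "given X_0 = x". [S] carries the discrete sigma-algebra. *)
Record markov_chain P Pr X : Prop := {
  chain_transition : transition_function P;
  chain_measurable : forall n (A : set S), measurable (X n @^-1` A);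
  chain_start : forall x, Pr x [set w | X 0%N w = x] = 1%E;
  chain_markov : forall x n (h : nat -> S) y, Pr x (history X n h) != 0%E ->
    cond_prob (Pr x) [set w | X n.+1 w = y] (history X n h) = P (h n) y }.

(* The infimum is +oo when x is never hit, and a minimum otherwise. *)
Definition hit_time X x (w : Omega) : \bar R :=
  ereal_inf [set (n%:R)%:E | n in [set n | (1 <= n)%N /\ X n w = x]].

Definition recurrent Pr X :=
  forall x, Pr x [set w | (hit_time X x w < +oo)%E] = 1%E.

Definition positive_recurrent Pr X :=
  forall x, (\int[Pr x]_w hit_time X x w < +oo)%E.

Definition invariant_density P (f : S -> R) : Prop :=
  [/\ forall x, 0 <= f x,
      (\esum_(x in [set: S]) (f x)%:E = 1)%E &
      forall y, (\esum_(x in [set: S]) (f x * P x y)%:E = (f y)%:E)%E].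

Definition hit_prob Pr X (e x : S) : R :=
  if x == e then 1 else fine (Pr e [set w | (hit_time X x w < hit_time X e w)%E]).

End MarkovChain.

Record upward_run_chain {R : realType} {d : Order.disp_t} {S : porderType d}
    {dO : measure_display} {Omega : measurableType dO} (e : S)
    (P : S -> S -> R) (Pr : S -> probability Omega R) (X : nat -> Omega -> S)
    : Prop := {
  run_markov : markov_chain P Pr X;
  run_support : forall x y, 0 < P x y <-> cover_set x y \/ y = e }.

(* Main.v *)
Require Import Defs.
From HB Require Import structures.
From mathcomp Require Import all_boot all_order all_algebra.
From mathcomp Require Import all_classical all_reals all_analysis.
From mathcomp Require Import measurable_realfun.
Import Order.TTheory GRing.Theory Num.Theory.
Import numFieldNormedType.Exports.
Local Open Scope classical_set_scope.
Local Open Scope ring_scope.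

(** The bridge from the process to the covering graph is that all events in
    the theorem concern the first time at which the trajectory satisfies a
    condition.  Such an event is a disjoint union of cylinders, so its
    probability is a sum of weights of words ([probability_trajectory]).  A word
    without the letter [e] has nonzero weight only if each letter covers the
    preceding one, so only paths of the covering graph contribute.  As paths
    increase strictly, they visit their endpoint once and never return to [e];
    this gives the path formulas for [F] and for the law of the return time to
    [e] ([hit_prob_paths], [survival_paths]).

    Recurrence.  The probability of surviving [n] steps away from [e] tends to
    the probability of never returning to [e].  What remains is that an almost
    sure return to [e] forces an almost sure return to every [x].  The chain
    then passes through [e] from every state, so the probability of ever hitting
    [x] is smallest from [e]; a minimum principle along a path from [e] to [x]
    shows that this smallest value is [1] ([recurrent_start]).  A path from [e]
    to [x] exists because the chains below [x] are finite ([covering_ind]).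

    Positive recurrence.  The expected return time to [e] is the sum of the path
    weights over all lengths, that is, [mu] ([expected_return_start]).
    Splitting off the last edge of a path shows that [F] satisfies the balance
    equation at each state other than [e], and conservation of mass gives the
    one at [e] when [mu] is finite ([hit_prob_invariant]).  A finite invariant
    mass function bounds the expected return time to each [x] by [mu / F x]
    ([stationary_return]).  Finally the balance equations off [e] determine an
    invariant function from its value at [e] by well-founded induction, so the
    invariant density is [F] normalized ([invariant_densityP]). *)

(** * Sums over arbitrary index sets *)

Section ESum.
Context {R : realType}.
Local Open Scope ereal_scope.

Lemma esumZl {T : choiceType} (A : set T) (c : \bar R) (a : T -> \bar R) :
  c \is a fin_num -> 0 <= c -> (forall i, 0 <= a i) ->
  \esum_(i in A) (c * a i) = c * \esum_(i in A) a i.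
Proof.
move=> cfin c0 a0; rewrite -(fineK cfin) /esum -ereal_supZl; last first.
- by rewrite fine_ge0.
- apply/set0P; exists 0; exists set0; first exact: fsets_set0.
  by rewrite fsbig_set0.
congr ereal_sup; rewrite image_comp; apply: eq_imagel => B _ /=.
by rewrite ge0_mule_fsumr.
Qed.

Lemma esum_support {T : choiceType} (A B : set T) (a : T -> \bar R) :
  A `<=` B -> (forall i, B i -> ~ A i -> a i = 0) ->
  \esum_(i in A) a i = \esum_(i in B) a i.
Proof.
move=> AB a0; rewrite esum_mkcond [RHS]esum_mkcond; apply: eq_esum => i _.
case: ifPn => [/set_mem/AB/mem_set ->//|]; rewrite notin_setE => nA.
by case: ifPn => // /set_mem Bi; rewrite a0.
Qed.

Lemma exchange_esum {T U : choiceType} (A : set T) (B : set U)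
    (a : T -> U -> \bar R) : (forall i j, 0 <= a i j) ->
  \esum_(i in A) \esum_(j in B) a i j = \esum_(j in B) \esum_(i in A) a i j.
Proof.
move=> a0; rewrite !esum_esum//.
apply: (reindex_esum _ _ (fun p => (p.2, p.1))); split => //=.
- by move=> [j i] [].
- by move=> [j i] [j' i'] _ _ /= [-> ->].
- by move=> [i j] [/= Ai Bj]; exists (j, i).
Qed.

Lemma esum_fibers {T U : choiceType} (f : T -> U) (A : set T)
    (a : T -> \bar R) : (forall i, 0 <= a i) ->
  \esum_(i in A) a i
    = \esum_(k in [set: U]) \esum_(i in [set i | A i /\ f i = k]) a i.
Proof.
move=> a0; rewrite esum_esum//; apply/esym.
apply: (reindex_esum _ _ (fun i => (f i, i))); split => //=.
- by move=> i j _ _ [].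
- by move=> [k i] [_ /= [Ai <-]]; exists i.
Qed.

Lemma esum_delta {T : choiceType} (i0 : T) (a : T -> \bar R) :
  0 <= a i0 ->
  \esum_(i in [set: T]) (if i == i0 then a i else 0) = a i0.
Proof.
move=> a0; rewrite -(@esum_support _ [set i0]) ?esum_set1 ?eqxx//.
by move=> i _ /eqP/negbTE ->.
Qed.

End ESum.

(** * Induction in an upward poset *)

Section UpwardPoset.
Context {d : Order.disp_t} {S : porderType d} {e : S}.
Hypothesis hS : upward_poset e.

(** The range of [u] together with [e] and [x] would be an infinite chain from
    [e] to [x].  Both directions of monotonicity are needed: decreasing
    sequences give well-foundedness, increasing ones give the existence of a
    lower neighbour. *)
Lemma no_infinite_bounded_chain (u : nat -> S) (x : S) :
  (forall n, (u n <= x)%O) ->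
  (forall m n, (m < n)%N -> (u m < u n)%O) \/
  (forall m n, (m < n)%N -> (u n < u m)%O) -> False.
Proof.
move=> ux mono.
have cmp m n : (u m <= u n)%O \/ (u n <= u m)%O.
  case: (ltngtP m n) => [mn|mn|->]; last by left.
  - by case: mono => mono; have /ltW := mono _ _ mn; auto.
  - by case: mono => mono; have /ltW := mono _ _ mn; auto.
have uinj : injective u.
  move=> m n E; apply/eqP; case: (ltngtP m n) => // mn; exfalso;
    by case: mono => mono; have := mono _ _ mn; rewrite E ltxx.
have e_le := poset_min hS.
have /(poset_chain_finite hS) finC : chain_between (range u `|` [set e; x]) e x.
  split.
  - move=> a b; case=> [[m _ <-]|[]->]; case=> [[n _ <-]|[]->]; auto.
  - by right; left.
  - by right; right.
  - by move=> t [[m _ <-]|[]->].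
have /finite_range_cst_subsequence [y [A Ainf Ay]] : finite_set (range u).
  by apply: sub_finite_set finC; exact: subsetUl.
apply: Ainf; have [[k Ak]|A0] := pselect (exists k, A k).
  apply: (@sub_finite_set _ _ [set k]); last exact: finite_set1.
  by move=> j /Ay uj; apply: uinj; rewrite uj; apply/esym/Ay.
suff -> : A = set0 by exact: finite_set0.
by rewrite -subset0 => j Aj; apply: A0; exists j.
Qed.

Lemma exists_minimal (A : set S) : A !=set0 -> exists y, minimal_in A y.
Proof.
move=> [x0 Ax0]; apply: contrapT => nmin.
have step (a : {t | A t}) : {b : {t | A t} | (sval b < sval a)%O}.
  apply: cid; apply: contrapT => nb; apply: nmin; exists (sval a).
  split; first exact: svalP.
  by move=> t At ta; apply: nb; exists (exist _ t At).
have [u [u0 us]] := dependent_choice step (exist _ x0 Ax0).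
have dec : forall m n, (m < n)%N -> (sval (u n) < sval (u m))%O.
  move=> m n; elim: n => // n IH; rewrite ltnS leq_eqVlt => /orP[/eqP ->//|/IH].
  exact: lt_trans.
apply: (@no_infinite_bounded_chain (fun n => sval (u n)) x0); last by right.
by case=> [|n]; [rewrite u0|have := dec 0%N n.+1 isT; rewrite u0 => /ltW].
Qed.

Lemma exists_maximal (A : set S) (x : S) :
  A !=set0 -> (forall t, A t -> (t <= x)%O) ->
  exists2 y, A y & forall t, A t -> ~ (y < t)%O.
Proof.
move=> [x0 Ax0] Ax; apply: contrapT => nmax.
have step (a : {t | A t}) : {b : {t | A t} | (sval a < sval b)%O}.
  apply: cid; apply: contrapT => nb; apply: nmax; exists (sval a).
    exact: svalP.
  by move=> t At ta; apply: nb; exists (exist _ t At).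
have [u [u0 us]] := dependent_choice step (exist _ x0 Ax0).
have inc : forall m n, (m < n)%N -> (sval (u m) < sval (u n))%O.
  move=> m n; elim: n => // n IH; rewrite ltnS leq_eqVlt => /orP[/eqP ->//|/IH].
  by move/lt_trans; apply.
apply: (@no_infinite_bounded_chain (fun n => sval (u n)) x); last by left.
by move=> n; apply: Ax; exact: svalP.
Qed.

Lemma upward_strong_ind (Q : S -> Prop) :
  (forall x, (forall t, (t < x)%O -> Q t) -> Q x) -> forall x, Q x.
Proof.
move=> step x; apply: contrapT => nQx.
have [y [nQy ymin]] := @exists_minimal [set t | ~ Q t] (ex_intro _ x nQx).
by apply/nQy/step => t ty; apply: contrapT => /ymin/(_ ty).
Qed.

(** Every [x] is reached from [e] along the covering graph: [x] covers any
    maximal element of the set of elements strictly below it, and this element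
    is reached by the well-foundedness of the order. *)
Lemma covering_ind (Q : S -> Prop) :
  Q e -> (forall x y, Q x -> covers y x -> Q y) -> forall x, Q x.
Proof.
move=> Qe step x; elim/upward_strong_ind: x => x IH.
have [<-//|ex] := eqVneq e x.
have e_lt : (e < x)%O by rewrite lt_neqAle ex (poset_min hS).
have [|t /ltW//|y yx ymax] := @exists_maximal [set t | (t < x)%O] x.
  by exists e.
apply: (step y); first exact: IH.
by split => // t yt tx; exact: ymax yt.
Qed.

Lemma covers_lt (x y : S) : covers y x -> (x < y)%O.
Proof. by case. Qed.

End UpwardPoset.

(** * Words and first visits *)

Section Words.
Context {S : eqType}.
Implicit Types (a b : seq S) (B : set (seq S)) (x z : S).

Definition prefix_free B := forall a b, B a -> B (a ++ b) -> b = [::].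

(** [x] occurs in [a], and its only occurrence is the last letter: [index x a]
    is [size a] when [x] is absent, so the equation also excludes that case. *)
Definition first_hit x a := (index x a).+1 == size a.

Lemma first_hit_mem x a : first_hit x a -> x \in a.
Proof. by move=> /eqP E; rewrite -index_mem -E. Qed.

Lemma first_hit_prefix_free x : prefix_free [set a | first_hit x a].
Proof.
move=> a b /= ha /eqP; rewrite index_cat (first_hit_mem _ _ ha) (eqP ha).
by rewrite size_cat -{1}[size a]addn0 => /addnI/esym/size0nil.
Qed.

Lemma first_hit_cons x z a :
  first_hit x (z :: a) = if z == x then a == [::] else first_hit x a.
Proof. by rewrite /first_hit /= eqSS; case: (z == x) => //; case: a. Qed.

End Words.

(** * Weights of words *)

Section PathWeight.
Context {R : realType} {S : choiceType} (P : S -> S -> R).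

Lemma path_weight_nil y : path_weight P y [::] = 1.
Proof. by rewrite /path_weight big_ord0. Qed.

Lemma path_weight_cons y z a :
  path_weight P y (z :: a) = P y z * path_weight P z a.
Proof.
rewrite /path_weight big_ord_recl /=; congr (_ * _); apply: eq_bigr => i _.
congr (P _ _); apply: set_nth_default => /=.
  exact: leq_trans (ltn_ord i) (leqnSn _).
by rewrite add0n.
Qed.

Lemma path_weight_rcons y a z :
  path_weight P y (rcons a z) = path_weight P y a * P (last y a) z.
Proof.
elim: a y => [|t a IH] y /=.
  by rewrite path_weight_cons !path_weight_nil mulrC.
by rewrite !path_weight_cons IH mulrA.
Qed.

Hypothesis hP : transition_function P.

Lemma path_weight_ge0 y a : 0 <= path_weight P y a.
Proof. by apply: prodr_ge0 => i _; exact: (transition_ge0 hP). Qed.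

Local Open Scope ereal_scope.

Let P_ge0 y z : 0 <= (P y z)%:E.
Proof. by rewrite lee_fin (transition_ge0 hP). Qed.

Let w_ge0 y a : 0 <= (path_weight P y a)%:E.
Proof. by rewrite lee_fin path_weight_ge0. Qed.

Hint Resolve P_ge0 w_ge0 : core.

Lemma esum_transition_cst y (c : \bar R) : c \is a fin_num -> 0 <= c ->
  \esum_(z in [set: S]) (P y z)%:E * c = c.
Proof.
move=> cfin c0; under eq_esum do rewrite muleC.
by rewrite esumZl// (transition_sum1 hP) mule1.
Qed.

(** First-step decomposition: the words of [A] are sorted by their first
    letter. *)
Lemma esum_path_weight_cons (A : set (seq S)) y : ~ A [::] ->
  \esum_(a in A) (path_weight P y a)%:E
    = \esum_(z in [set: S]) (P y z)%:E *
        \esum_(a in [set a | A (z :: a)]) (path_weight P z a)%:E.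
Proof.
move=> A0; under [RHS]eq_esum => z _.
  rewrite -esumZl//.
  under eq_esum do rewrite -EFinM -path_weight_cons.
  over.
rewrite (@esum_esum _ _ _ _ _ (fun z a => (path_weight P y (z :: a))%:E))//.
apply: (reindex_esum _ _ (fun p => p.1 :: p.2)); split => //=.
- by move=> [z a] [].
- by move=> [z a] [z' a'] _ _ /= [-> ->].
- by move=> [//|z a] /= Aza; exists (z, a).
Qed.

(** Last-step decomposition. *)
Lemma esum_path_weight_rcons (A : set (seq S)) y z :
  \esum_(a in A) ((path_weight P y a)%:E * (P (last y a) z)%:E)
    = \esum_(b in [set rcons a z | a in A]) (path_weight P y b)%:E.
Proof.
rewrite esum_image; last by move=> a b _ _; exact: rcons_injl.
by apply: eq_esum => a _; rewrite path_weight_rcons EFinM.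
Qed.

(** An average of values that are all at least [m] can only be [m] if every
    value of positive weight is [m]: an excess [k] at [z0] would contribute
    [P y z0 * k] to the average. *)
Lemma min_principle y z0 (h : S -> \bar R) (m : \bar R) :
  m \is a fin_num -> 0 <= m -> (forall z, m <= h z) ->
  \esum_(z in [set: S]) (P y z)%:E * h z = m ->
  (0 < P y z0)%R -> h z0 = m.
Proof.
move=> mfin m0 mh sum_m p0.
apply/eqP; rewrite eq_le mh andbT leNgt; apply/negP => m_lt.
have [k [k0 mk]] : exists k : R, (0 < k)%R /\ m + k%:E <= h z0.
  case: m mfin {m0 mh sum_m} m_lt => // m _; case: (h z0) => // [r|].
    rewrite lte_fin => mr; exists (r - m)%R; rewrite subr_gt0; split => //.
    by rewrite -EFinD addrC subrK.
  by exists 1%R; rewrite leey.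
have : m + (P y z0 * k)%:E <= m.
  rewrite -{2}sum_m -{1}(esum_transition_cst y m mfin m0).
  rewrite -[X in _ + X](@esum_delta _ _ z0 (fun z => (P y z * k)%:E));
    last first.
    by rewrite lee_fin mulr_ge0 // ltW.
  rewrite -esumD; last 2 first.
  - by move=> z _; rewrite mule_ge0.
  - move=> z _; case: ifP => // _.
    by rewrite lee_fin mulr_ge0 ?(transition_ge0 hP)// ltW.
  apply: le_esum => z _; case: ifP => [/eqP ->|_].
    rewrite EFinM -muleDr//; first by rewrite lee_wpmul2l.
    by rewrite ge0_adde_def// inE // lee_fin ltW.
  by rewrite adde0 lee_wpmul2l.
apply/negP; rewrite -ltNge -(fineK mfin) -EFinD lte_fin ltrDl mulr_gt0//.
Qed.

End PathWeight.

(** * The law of the trajectory *)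

Lemma countable_seq {T : choiceType} :
  countable [set: T] -> countable [set: seq T].
Proof.
move=> /countable_injP[f finj]; apply/countable_injP.
exists (fun s => pickle (map f s)) => s t _ _ /(pcan_inj pickleK).
by apply: inj_map => x y; apply: finj; rewrite inE.
Qed.

(** Countable additivity for families indexed by any countable type; an
    injection into [nat] reduces it to the version for sequences of sets. *)
Lemma measure_bigcup_esum {R : realType} {d : measure_display}
    {Omega : measurableType d} (mu : {measure set Omega -> \bar R})
    {T : choiceType} (cT : countable [set: T]) (B : set T)
    (G : T -> set Omega) :
  (forall a, measurable (G a)) -> trivIset B G ->
  mu (\bigcup_(a in B) G a) = (\esum_(a in B) mu (G a))%E.
Proof.
move=> mG tG; have /countable_injP[f finj'] := cT.
have finj a b : f a = f b -> a = b by apply: finj'; rewrite inE.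
pose F n := \bigcup_(a in [set a | B a /\ f a = n]) G a.
have FE a : B a -> F (f a) = G a.
  move=> Ba; apply/seteqP; split=> [w [b [Bb /finj ->]] //|w Gw].
  by exists a.
have -> : \bigcup_(a in B) G a = \bigcup_(n in f @` B) F n.
  rewrite bigcup_image; apply: eq_bigcupr => a Ba; exact/esym/FE.
rewrite measure_bigcup; last 2 first.
- by move=> _ [a Ba <-]; rewrite FE.
- move=> _ _ [a Ba <-] [b Bb <-]; rewrite !FE// => /(tG _ _ Ba Bb) -> //.
rewrite nneseries_esum//.
rewrite set_mem_set esum_image; last by move=> a b _ _; exact: finj.
by apply: eq_esum => a Ba; rewrite FE.
Qed.

Section Cylinders.
Context {R : realType} {S : choiceType} {dO : measure_display}
  {Omega : measurableType dO}.
Context {P : S -> S -> R} {Pr : S -> probability Omega R}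
  {X : nat -> Omega -> S}.
Hypothesis mc : markov_chain P Pr X.
Implicit Types (a b : seq S) (B : set (seq S)) (w : Omega) (x y : S).

(** The initial state is left out, so that a trajectory is compared directly
    with the word that encodes a path. *)
Definition trajectory n w : seq S := mkseq (fun i => X i.+1 w) n.

Definition cylinder y a : set Omega :=
  [set w | X 0%N w = y /\ trajectory (size a) w = a].

Lemma trajectoryS n w : trajectory n.+1 w = rcons (trajectory n w) (X n.+1 w).
Proof. by rewrite /trajectory mkseqS. Qed.

Lemma size_trajectory n w : size (trajectory n w) = n.
Proof. exact: size_mkseq. Qed.

Lemma take_trajectory m n w : (m <= n)%N ->
  take m (trajectory n w) = trajectory m w.
Proof.
by move=> mn; rewrite /trajectory /mkseq -map_take take_iota (minn_idPl mn).
Qed.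

Lemma cylinder_rcons y a z :
  cylinder y (rcons a z) = cylinder y a `&` (X (size a).+1 @^-1` [set z]).
Proof.
rewrite /cylinder size_rcons; apply/seteqP; split=> w /=.
  by rewrite trajectoryS => -[-> /eqP]; rewrite eqseq_rcons =>
    /andP[/eqP -> /eqP].
by rewrite trajectoryS => -[[-> ->] ->].
Qed.

Lemma cylinder_nil y : cylinder y [::] = X 0%N @^-1` [set y].
Proof. by apply/seteqP; split=> w /=; [case|split]. Qed.

Lemma measurable_cylinder y a : measurable (cylinder y a).
Proof.
elim/last_ind: a => [|a z IH].
  by rewrite cylinder_nil; exact: (chain_measurable mc).
by rewrite cylinder_rcons; apply: measurableI => //;
  exact: (chain_measurable mc).
Qed.

Lemma history_cylinder y a :
  history X (size a) (fun i => nth y (y :: a) i) = cylinder y a.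
Proof.
apply/seteqP; split=> w /=.
  move=> H; split; first exact: (H 0%N).
  apply: (@eq_from_nth _ y); rewrite size_trajectory// => i ia.
  by rewrite nth_mkseq// (H i.+1).
move=> [w0 wa] [|i] //= ia.
by rewrite -wa nth_mkseq// -(size_trajectory (size a) w) wa.
Qed.

(** Induction on the last letter: the Markov property multiplies the
    probability by the last transition, and if the past has probability zero,
    both sides vanish. *)
Lemma probability_cylinder y a : Pr y (cylinder y a) = (path_weight P y a)%:E.
Proof.
elim/last_ind: a => [|a z IH].
  by rewrite cylinder_nil path_weight_nil -(chain_start mc y).
rewrite cylinder_rcons path_weight_rcons.
have [a0|an0] := eqVneq (path_weight P y a) 0%R.
  rewrite a0 mul0r; apply/eqP; rewrite eq_le measure_ge0 andbT.
  apply: (@le_trans _ _ (Pr y (cylinder y a))); last by rewrite IH a0.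
  by apply: le_measure => [||w []//]; rewrite inE; [apply: measurableI|];
    first [exact: measurable_cylinder|exact: (chain_measurable mc)].
have := chain_markov mc (x:=y) (n := size a) (h := fun i => nth y (y :: a) i) z.
rewrite history_cylinder IH eqe => /(_ an0).
have -> : nth y (y :: a) (size a) = last y a by rewrite -last_nth.
rewrite /cond_prob IH /= => <-.
rewrite mulrC -mulrA mulVf// mulr1 fineK.
  by rewrite setIC.
by apply: fin_num_measure; apply: measurableI;
  [exact: (chain_measurable mc _ [set z])|exact: measurable_cylinder].
Qed.

(** Hitting times look at the chain from time [1] on, whereas a cylinder also
    fixes the initial state; the two differ by a null event. *)
Lemma probability_start y A : measurable A ->
  Pr y A = Pr y (A `&` (X 0%N @^-1` [set y])).
Proof.
move=> mA; have mX : measurable (X 0%N @^-1` [set y]).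
  exact: (chain_measurable mc).
rewrite (measureDI (Pr y) mA mX) -[RHS]add0e; congr (_ + _)%E.
apply/eqP; rewrite eq_le measure_ge0 andbT.
apply: (@le_trans _ _ (Pr y (~` (X 0%N @^-1` [set y])))).
  by apply: le_measure => [||w []//]; rewrite inE;
    [exact: measurableD|exact: measurableC].
rewrite probability_setC// [X in (_ - X)%E](_ : _ = 1%E) ?subee//.
exact: (chain_start mc).
Qed.

Hypothesis cS : countable [set: S].

Lemma measurable_trajectory B :
  measurable [set w | exists n, B (trajectory n w)].
Proof.
have -> : [set w | exists n, B (trajectory n w)]
    = \bigcup_y \bigcup_a (if a \in B then cylinder y a else set0).
  apply/seteqP; split=> w /=.
    move=> [n Bn]; exists (X 0%N w) => //; exists (trajectory n w) => //.
    by rewrite mem_set// /cylinder /= size_trajectory.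
  move=> [y _ [a _]]; case: ifPn => // /set_mem Ba [_ wa].
  by exists (size a); rewrite wa.
apply: countable_bigcupT_measurable => // y.
apply: countable_bigcupT_measurable; first exact: countable_seq.
by move=> a; case: ifP => // _; exact: measurable_cylinder.
Qed.

(** The bridge between the chain and sums over words: for a prefix-free [B] at
    most one initial segment of a trajectory lies in [B], so the event is a
    countable disjoint union of cylinders. *)
Lemma probability_trajectory B y : prefix_free B ->
  Pr y [set w | exists n, B (trajectory n w)]
    = (\esum_(a in B) (path_weight P y a)%:E)%E.
Proof.
move=> pB; rewrite probability_start; last exact: measurable_trajectory.
under eq_esum do rewrite -probability_cylinder.
rewrite -(measure_bigcup_esum _ (countable_seq cS)); last 2 first.
- exact: measurable_cylinder.
- move=> a b Ba Bb [w [[_ wa] [_ wb]]].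
  wlog ab : a b Ba Bb wa wb / (size a <= size b)%N.
    by move=> H; case/orP: (leq_total (size a) (size b)) => ?; [|apply/esym];
      apply: H.
  have /esym E : take (size a) b = a by rewrite -wb take_trajectory// wa.
  have := cat_take_drop (size a) b; rewrite -E => bE.
  by rewrite -bE (pB a (drop (size a) b)) ?cats0// bE.
congr (Pr y _); apply/seteqP; split=> w /=.
  by move=> [[n Bn] w0]; exists (trajectory n w) => //;
    rewrite /cylinder /= size_trajectory.
by move=> [a Ba [w0 wa]]; split => //; exists (size a); rewrite wa.
Qed.

(** * Hitting times *)

Local Notation tau := (@hit_time R S dO Omega X).

Lemma mem_trajectory x n w :
  x \in trajectory n w -> exists2 k, (k < n)%N & X k.+1 w = x.
Proof. by move=> /mapP[k]; rewrite mem_iota /= add0n => kn ->; exists k. Qed.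

Lemma trajectory_mem n w k : (k < n)%N -> X k.+1 w \in trajectory n w.
Proof. by move=> kn; apply: map_f; rewrite mem_iota. Qed.

Lemma hit_time_le x n w : (0 < n)%N -> X n w = x ->
  (tau x w <= (n%:R)%:E)%E.
Proof. by move=> n0 nx; apply: ereal_inf_lbound; exists n. Qed.

Lemma hit_time_gt x n w :
  ((n%:R)%:E < tau x w)%E <-> x \notin trajectory n w.
Proof.
split.
  move=> nT; apply/negP => /mem_trajectory[k kn kx].
  have := lt_le_trans nT (hit_time_le _ _ _ (ltn0Sn k) kx).
  by rewrite lte_fin ltr_nat ltnNge kn.
move=> nx; apply: (@lt_le_trans _ _ (n.+1%:R)%:E);
  first by rewrite lte_fin ltr_nat.
apply: le_ereal_inf_tmp => _ [[|k] [] // _ kx <-].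
rewrite lee_fin ler_nat ltnS leqNgt; apply: contra nx => kn.
by rewrite -kx trajectory_mem.
Qed.

(** The first visit to [x] is the time [n] at which the trajectory of length [n]
    first contains [x]; that time is a hitting time below [t] as soon as some
    visit occurs before [t]. *)
Lemma hit_time_lt x w (t : \bar R) :
  (tau x w < t)%E <->
  exists n, first_hit x (trajectory n w) /\ ((n%:R)%:E < t)%E.
Proof.
split.
  move=> /ereal_inf_lt[_ [[|k] [] // _ kx <-] kt].
  have xk : x \in trajectory k.+1 w by rewrite -kx trajectory_mem.
  have ik : (index x (trajectory k.+1 w) < k.+1)%N.
    by rewrite -[X in (_ < X)%N](size_trajectory k.+1 w) index_mem.
  exists (index x (trajectory k.+1 w)).+1; split; last first.
    by apply: le_lt_trans kt; rewrite lee_fin ler_nat.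
  have := cat_take_drop (index x (trajectory k.+1 w)).+1 (trajectory k.+1 w).
  rewrite take_trajectory// => E.
  rewrite /first_hit size_trajectory eqSS; apply/eqP.
  rewrite -[in RHS]E index_cat.
  by rewrite -(take_trajectory _ _ _ ik) in_take// leqnn.
move=> [n [hn nt]]; apply: le_lt_trans nt.
have /mem_trajectory[k kn kx] := first_hit_mem _ _ hn.
apply: (@le_trans _ _ (k.+1%:R)%:E); last by rewrite lee_fin ler_nat.
exact: hit_time_le.
Qed.

(** A time with values in the positive integers or infinity counts the [n] that
    it exceeds; integrating this series gives the expectation as a sum of tail
    probabilities. *)
Lemma hit_time_series x w : tau x w
  = (\sum_(n <oo) (\1_[set w | ((n%:R)%:E < tau x w)%E] w)%:E)%E.
Proof.
have ind n : (\1_[set w | ((n%:R)%:E < tau x w)%E] w : R)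
    = (x \notin trajectory n w)%:R.
  rewrite indicE; congr (nat_of_bool _)%:R.
  by apply/idP/idP => [/set_mem/hit_time_gt|/hit_time_gt/mem_set].
under eq_eseriesr do rewrite ind.
have [Too|/hit_time_lt[[|m] [hm _]]] := leP +oo%E (tau x w) => //.
  have T_oo : tau x w = +oo%E by apply/eqP; rewrite eq_le leey.
  rewrite T_oo; apply/esym/eqyP => A A0.
  apply: le_trans (nneseries_lim_ge (Num.truncn A).+1 _) => //.
  under eq_bigr => n _.
    have /hit_time_gt -> : ((n%:R)%:E < tau x w)%E by rewrite T_oo ltry.
    over.
  rewrite /= sumEFin lee_fin big_const_nat subn0 iter_addr addr0.
  by rewrite ltW// truncnS_gt.
have xm : x \notin trajectory m w.
  move: hm; rewrite /first_hit size_trajectory eqSS trajectoryS -cats1.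
  rewrite index_cat; case: ifP => // xm /eqP E.
  by move: xm; rewrite -index_mem E size_trajectory ltnn.
have xin k : (x \notin trajectory k w) = (k < m.+1)%N.
  apply/idP/idP => [nx|km].
    rewrite ltnNge; apply: contra nx => mk.
    have := first_hit_mem _ _ hm; rewrite -(take_trajectory m.+1 k w)//.
    exact: mem_take.
  by apply: contra xm; rewrite -(take_trajectory k m w)//; exact: mem_take.
have -> : tau x w = (m.+1%:R)%:E.
  apply/eqP; rewrite eq_le; apply/andP; split.
    have /mem_trajectory[k km kx] := first_hit_mem _ _ hm.
    apply: le_trans (hit_time_le _ _ _ (ltn0Sn k) kx) _.
    by rewrite lee_fin ler_nat.
  apply: le_ereal_inf_tmp => _ [[|k] [] // _ kx <-]; rewrite lee_fin ler_nat.
  by rewrite ltnNge -ltnS -xin -kx negbK trajectory_mem// ltnS.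
rewrite (nneseries_split 0 m.+1)// add0n [X in (_ + X)%E]eseries0 ?adde0.
  rewrite big_nat; under eq_bigr => k /andP[_ km] do rewrite xin km.
  by rewrite -big_nat sumEFin big_const_nat subn0 iter_addr addr0.
by move=> k mk _; rewrite xin ltnNge mk.
Qed.

Lemma probability_hit_time_gt x y n :
  Pr y [set w | ((n%:R)%:E < tau x w)%E]
    = (\esum_(a in [set a | size a = n /\ x \notin a])
         (path_weight P y a)%:E)%E.
Proof.
rewrite -probability_trajectory.
  congr (Pr y _); apply/seteqP; split=> w /=.
    by move=> /hit_time_gt nx; exists n; rewrite size_trajectory.
  by move=> [k []]; rewrite size_trajectory => -> nx; exact/hit_time_gt.
move=> a b [an _] [+ _]; rewrite size_cat -an => /eqP.
by rewrite -{2}[size a]addn0 eqn_add2l size_eq0 => /eqP.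
Qed.

Lemma probability_hit_time_fin x y :
  Pr y [set w | (tau x w < +oo)%E]
    = (\esum_(a in [set a | first_hit x a]) (path_weight P y a)%:E)%E.
Proof.
rewrite -probability_trajectory; last exact: first_hit_prefix_free.
congr (Pr y _); apply/seteqP; split=> w /=.
  by move=> /hit_time_lt[n [hn _]]; exists n.
by move=> [n hn]; apply/hit_time_lt; exists n; rewrite ltry.
Qed.

Lemma probability_hit_time_lt x z y :
  Pr y [set w | (tau x w < tau z w)%E]
    = (\esum_(a in [set a | first_hit x a /\ z \notin a])
         (path_weight P y a)%:E)%E.
Proof.
rewrite -probability_trajectory.
  congr (Pr y _); apply/seteqP; split=> w /=.
    by move=> /hit_time_lt[n [hn /hit_time_gt nz]]; exists n.
  by move=> [n [hn nz]]; apply/hit_time_lt; exists n; split => //;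
    exact/hit_time_gt.
by move=> a b [ha _] [hab _]; exact: first_hit_prefix_free ha hab.
Qed.

Lemma measurable_hit_time_gt x n :
  measurable [set w | ((n%:R)%:E < tau x w)%E].
Proof.
have := measurable_trajectory [set a | size a = n /\ x \notin a].
congr measurable; apply/seteqP; split=> w /=.
  by move=> [k []]; rewrite size_trajectory => -> nx; exact/hit_time_gt.
by move=> /hit_time_gt nx; exists n; rewrite size_trajectory.
Qed.

Lemma expected_hit_time x y :
  (\int[Pr y]_w tau x w
    = \sum_(n <oo) Pr y [set w | ((n%:R)%:E < tau x w)%E])%E.
Proof.
under eq_integral do rewrite hit_time_series.
rewrite integral_nneseries//; last first.
  by move=> n; apply/measurable_EFinP/measurable_indic/measurable_hit_time_gt.
apply: eq_eseriesr => n _; rewrite integral_indic// ?setIT//.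
exact: measurable_hit_time_gt.
Qed.

End Cylinders.

(** * First-step equations, restarts and stationary returns *)

Section HittingProbabilities.
Context {R : realType} {S : choiceType} {dO : measure_display}
  {Omega : measurableType dO}.
Context {P : S -> S -> R} {Pr : S -> probability Omega R}
  {X : nat -> Omega -> S}.
Hypothesis mc : markov_chain P Pr X.
Hypothesis cS : countable [set: S].
Local Open Scope ereal_scope.

Let hP : transition_function P := chain_transition mc.

Let P_ge0 y z : 0 <= (P y z)%:E.
Proof. by rewrite lee_fin (transition_ge0 hP). Qed.

Let w_ge0 y a : 0 <= (path_weight P y a)%:E.
Proof. by rewrite lee_fin (path_weight_ge0 _ hP). Qed.

Hint Resolve P_ge0 w_ge0 : core.

Local Notation tau := (@hit_time R S dO Omega X).

Definition avoid_prob x n y : \bar R :=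
  Pr y [set w | (n%:R)%:E < tau x w].

Definition ever_prob x y : \bar R := Pr y [set w | tau x w < +oo].

Lemma avoid_prob0 x y : avoid_prob x 0 y = 1.
Proof.
rewrite /avoid_prob (probability_hit_time_gt mc cS).
have -> : [set a | size a = 0%N /\ x \notin a] = [set [::]].
  by apply/seteqP; split=> [a [/size0nil ->]|a ->].
by rewrite esum_set1 ?path_weight_nil.
Qed.

Lemma avoid_probS x n y : avoid_prob x n.+1 y
  = \esum_(z in [set: S])
      (P y z)%:E * (if z == x then 0 else avoid_prob x n z).
Proof.
rewrite /avoid_prob (probability_hit_time_gt mc cS).
rewrite (esum_path_weight_cons _ hP); last by case.
apply: eq_esum => z _; congr (_ * _); case: eqP => [->|/eqP zx].
  by apply: esum1 => a /= []; rewrite mem_head.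
rewrite (probability_hit_time_gt mc cS); congr esum.
apply/seteqP; split=> a /=; rewrite inE negb_or eq_sym zx.
  by move=> [[->]].
by move=> [->].
Qed.

Lemma ever_probS x y : ever_prob x y
  = \esum_(z in [set: S]) (P y z)%:E * (if z == x then 1 else ever_prob x z).
Proof.
rewrite /ever_prob (probability_hit_time_fin mc cS).
rewrite (esum_path_weight_cons _ hP)//.
apply: eq_esum => z _; congr (_ * _).
rewrite (_ : [set a | _] = [set a | first_hit x (z :: a)])//.
under [X in esum X]eq_set do rewrite first_hit_cons.
case: eqP => [->|/eqP zx]; last by rewrite (probability_hit_time_fin mc cS).
have -> : [set a | a == [::]] = [set [::] : seq S].
  by apply/seteqP; split=> a /= => [/eqP|->].
by rewrite esum_set1 ?path_weight_nil.
Qed.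

Lemma avoid_prob_fin x n y : avoid_prob x n y \is a fin_num.
Proof. by apply: fin_num_measure; exact: (measurable_hit_time_gt mc cS). Qed.

Lemma measurable_hit_time_fin x : measurable [set w | tau x w < +oo].
Proof.
have := measurable_trajectory mc cS [set a | first_hit x a].
congr measurable; apply/seteqP; split=> w /=.
  by move=> [n hn]; apply/hit_time_lt; exists n; rewrite ltry.
by move=> /hit_time_lt[n [hn _]]; exists n.
Qed.

Lemma ever_prob_fin x y : ever_prob x y \is a fin_num.
Proof. by apply: fin_num_measure; exact: measurable_hit_time_fin. Qed.

Lemma ever_prob_le1 x y : ever_prob x y <= 1.
Proof. by apply: probability_le1; exact: measurable_hit_time_fin. Qed.

Lemma avoid_prob_ge0 x n y : 0 <= avoid_prob x n y.
Proof. exact: measure_ge0. Qed.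

Lemma ever_prob_ge0 x y : 0 <= ever_prob x y.
Proof. exact: measure_ge0. Qed.

Hint Resolve avoid_prob_ge0 ever_prob_ge0 : core.

(** Continuity from above: the events decrease to that of never hitting [x]. *)
Lemma cvg_avoid_prob x y :
  avoid_prob x n y @[n --> \oo] --> 1 - ever_prob x y.
Proof.
have -> : 1 - ever_prob x y = Pr y (\bigcap_n [set w | (n%:R)%:E < tau x w]).
  rewrite -probability_setC; last exact: measurable_hit_time_fin.
  congr (Pr y _); apply/seteqP; split=> w /=.
    move=> /negP; rewrite -leNgt => Too n _ /=.
    by apply: lt_le_trans Too; rewrite ltry.
  move=> H /hit_time_lt[n [hn _]].
  by have /hit_time_gt := H n I; rewrite (first_hit_mem _ _ hn).
apply: nonincreasing_cvg_mu.
- by rewrite (le_lt_trans (probability_le1 _ _)) ?ltry//;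
    exact: (measurable_hit_time_gt mc cS).
- by move=> n; exact: (measurable_hit_time_gt mc cS).
- by apply: bigcap_measurable => // n _; exact: (measurable_hit_time_gt mc cS).
- move=> m n mn; apply/subsetPset => w /=; apply: le_lt_trans.
  by rewrite lee_fin ler_nat.
Qed.

(** Maximum principle: by the first-step equation, [ever_prob x y] is an average
    of numbers at most [1], so each number of positive weight is [1].  It is
    obtained from [min_principle] applied to the complements. *)
Lemma ever_prob_reachable x y z :
  ever_prob x y = 1 -> (0 < P y z)%R -> z = x \/ ever_prob x z = 1.
Proof.
move=> e1 p0; have [->|zx] := eqVneq z x; [by left|right].
pose r t := if t == x then 1 else ever_prob x t.
have r0 t : 0 <= r t by rewrite /r; case: ifP.
have r1 t : r t <= 1 by rewrite /r; case: ifP => // _; exact: ever_prob_le1.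
have rfin t : r t \is a fin_num.
  by rewrite /r; case: ifP => // _; exact: ever_prob_fin.
have co0 t : 0 <= 1 - r t by rewrite sube_ge0// rfin.
have sum0 : \esum_(t in [set: S]) (P y t)%:E * (1 - r t) = 0.
  have : \esum_(t in [set: S]) (P y t)%:E * (1 - r t)
         + \esum_(t in [set: S]) (P y t)%:E * r t = 1.
    rewrite -esumD; [|by move=> t _; rewrite mule_ge0..].
    rewrite -[RHS](transition_sum1 hP y); apply: eq_esum => t _.
    by rewrite -ge0_muleDr// subeK// mule1.
  rewrite -ever_probS e1 => E.
  by rewrite -[LHS](@addeK _ 1)// E subee.
have /eqP := min_principle P hP y z _ 0 isT (lexx 0) co0 sum0 p0.
rewrite sube_eq ?rfin// add0e /r (negbTE zx) => /eqP <- //.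
Qed.

(** A chain started at [y] either avoids [e] for [n] steps or passes through
    [e], and from there it hits [x] with probability [ever_prob x e] unless it
    has done so before.  The first-step equations turn this into an induction
    on [n]. *)
Lemma le_ever_prob_restart e x y n :
  ever_prob x e <= ever_prob x y + avoid_prob e n y.
Proof.
elim: n y => [|n IH] y.
  by rewrite avoid_prob0; apply: le_trans (ever_prob_le1 x e) _; rewrite leeDr.
rewrite [X in _ <= X + _]ever_probS avoid_probS -esumD; last 2 first.
- by move=> z _; rewrite mule_ge0//; case: ifP.
- by move=> z _; rewrite mule_ge0//; case: ifP.
rewrite -(esum_transition_cst _ hP y _ (ever_prob_fin x e) (ever_prob_ge0 x e)).
apply: le_esum => z _; rewrite -ge0_muleDr; [|by case: ifP..].
apply: lee_wpmul2l => //; have [->|ze] := eqVneq z e; last first.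
  case: eqP => [_|_]; last exact: IH.
  by apply: le_trans (ever_prob_le1 x e) _; rewrite leeDl.
by rewrite adde0; case: eqP => // _; exact: ever_prob_le1.
Qed.

Section Invariant.
Context (F : S -> R).
Hypothesis F_ge0 : forall x, (0 <= F x)%R.
Hypothesis F_inv : forall y, \esum_(x in [set: S]) (F x * P x y)%:E = (F y)%:E.

Let EF_ge0 x : 0 <= (F x)%:E.
Proof. by rewrite lee_fin. Qed.
Hint Resolve EF_ge0 : core.

(** Averaging [g] over one more step does not change its integral against an
    invariant mass function. *)
Lemma invariant_esum (g : S -> \bar R) :
  (forall z, 0 <= g z) -> (forall z, g z \is a fin_num) ->
  \esum_(y in [set: S])
    (F y)%:E * (\esum_(z in [set: S]) (P y z)%:E * g z)
  = \esum_(z in [set: S]) (F z)%:E * g z.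
Proof.
move=> g0 gfin.
transitivity (\esum_(y in [set: S]) \esum_(z in [set: S])
    (F y)%:E * ((P y z)%:E * g z)).
  by apply: eq_esum => y _; rewrite esumZl// => z; rewrite mule_ge0.
rewrite exchange_esum; last by move=> y z; rewrite !mule_ge0.
apply: eq_esum => z _; rewrite -F_inv [RHS]muleC -esumZl//.
  by apply: eq_esum => y _; rewrite EFinM muleA muleC.
by move=> y; rewrite EFinM mule_ge0.
Qed.

(** Let the chain start from the invariant mass function [F].  The mass that
    avoids [x] at the times [1, ..., n] and starts elsewhere equals, by
    invariance, the mass that avoids [x] at the times [1, ..., n + 1].  Hence
    the mass [F x * avoid_prob x n x] that starts at [x] is a difference of
    consecutive terms, and the sum over [n] telescopes. *)
Lemma stationary_return x n :
  (F x)%:E * (\sum_(0 <= k < n) avoid_prob x k x)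
    + \esum_(y in [set: S]) (F y)%:E * avoid_prob x n y
  = \esum_(y in [set: S]) (F y)%:E.
Proof.
elim: n => [|n <-].
  rewrite big_nil mule0 add0e; apply: eq_esum => y _.
  by rewrite avoid_prob0 mule1.
rewrite big_nat_recr//= ge0_muleDr//; last exact: sume_ge0.
rewrite -addeA; congr (_ + _).
under eq_esum => y _ do rewrite avoid_probS.
rewrite invariant_esum; last 2 first.
- by move=> z; case: ifP.
- by move=> z; case: ifP => // _; exact: avoid_prob_fin.
rewrite -(esum_delta x (fun y => (F y)%:E * avoid_prob x n y)); last first.
  by rewrite mule_ge0.
rewrite -esumD; last 2 first.
- by move=> y _; case: ifP => // _; rewrite mule_ge0.
- by move=> y _; rewrite mule_ge0//; case: ifP.
by apply: eq_esum => y _; case: ifP => _; rewrite ?mule0 ?adde0 ?add0e.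
Qed.

(** By [stationary_return] the partial sums of the tail probabilities of the
    return time to [x] are at most the total mass divided by [F x]. *)
Lemma expected_return_lt x :
  (0 < F x)%R -> \esum_(y in [set: S]) (F y)%:E < +oo ->
  \int[Pr x]_w tau x w < +oo.
Proof.
move=> Fx0 mu_fin; rewrite (expected_hit_time mc cS).
set mu := (X in X < _) in mu_fin.
apply: (@le_lt_trans _ _ ((F x)^-1%:E * mu)); last first.
  rewrite lte_mul_pinfty// lee_fin invr_ge0//.
apply: lime_le; first by apply: is_cvg_nneseries => n _ _;
  exact: avoid_prob_ge0.
apply: nearW => n; rewrite -[leLHS]mul1e.
rewrite -[1](_ : (F x)^-1%:E * (F x)%:E = _); last first.
  by rewrite -EFinM mulVf// gt_eqF.
rewrite -muleA lee_pmul2l//; last by rewrite lte_fin invr_gt0.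
rewrite /mu -(stationary_return x n) leeDl// esum_ge0// => y _.
by rewrite mule_ge0.
Qed.

End Invariant.

End HittingProbabilities.

(** * Upward run chains *)

Section RunChain.
Context {R : realType} {d : Order.disp_t} {S : porderType d} {e : S}
  {dO : measure_display} {Omega : measurableType dO}.
Context {P : S -> S -> R} {Pr : S -> probability Omega R}
  {X : nat -> Omega -> S}.
Hypothesis hS : upward_poset e.
Hypothesis hX : upward_run_chain e P Pr X.
Local Open Scope ereal_scope.

Let mc : markov_chain P Pr X := run_markov hX.
Let hP : transition_function P := chain_transition mc.
Let cS : countable [set: S] := poset_countable hS.

Local Notation tau := (@hit_time R S dO Omega X).
Local Notation F := (hit_prob Pr X e).
Local Notation ever := (@ever_prob R S dO Omega Pr X).
Local Notation avoid := (@avoid_prob R S dO Omega Pr X).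
Local Notation w := (path_weight P e).

Let w_ge0 a : 0 <= (w a)%:E.
Proof. by rewrite lee_fin (path_weight_ge0 _ hP). Qed.
Hint Resolve w_ge0 : core.

Lemma transition_cover x y : covers y x -> (0 < P x y)%R.
Proof. by move=> yx; apply/(run_support hX); left. Qed.

Lemma transition_eq0 x y : y != e -> ~ covers y x -> P x y = 0%R.
Proof.
move=> ye nyx; apply/eqP; apply: contrapT => /negP p0.
have /(run_support hX)[//|ye'] : (0 < P x y)%R.
  by rewrite lt_neqAle eq_sym p0 (transition_ge0 hP).
by rewrite ye' eqxx in ye.
Qed.

Lemma covering_path_lt (y : S) a : path cover_edge y a -> path <%O y a.
Proof. by apply: sub_path => s t /asboolP/covers_lt. Qed.

Lemma paths_avoid_start a : paths e a -> e \notin a.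
Proof.
move=> /covering_path_lt; rewrite lt_path_sortedE => /andP[/allP ea _].
by apply/negP => /ea; rewrite ltxx.
Qed.

(** A step of positive probability goes to a cover or to [e]. *)
Lemma path_weight_off_paths y a :
  e \notin a -> ~ path cover_edge y a -> path_weight P y a = 0%R.
Proof.
elim: a y => [//|z a IH] y; rewrite inE negb_or eq_sym => /andP[ze ea].
rewrite path_weight_cons /= => npath.
have [yz|nyz] := pselect (covers z y); last by rewrite transition_eq0 ?mul0r.
by rewrite IH ?mulr0// => pa; apply: npath; rewrite pa andbT; exact/asboolP.
Qed.

(** Words that avoid [e] but are not paths have weight zero, and paths avoid [e]
    because they increase strictly. *)
Lemma esum_avoid_start (D : set (seq S)) :
  \esum_(a in [set a | D a /\ e \notin a]) (w a)%:E
    = \esum_(a in [set a | D a /\ paths e a]) (w a)%:E.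
Proof.
apply/esym/esum_support; first by move=> a [Da pa]; split => //;
  exact: paths_avoid_start.
by move=> a [Da ea] npath; rewrite path_weight_off_paths// => pa; apply: npath.
Qed.

(** A path has no repeated vertex, so it visits its endpoint for the first time
    at its end. *)
Lemma first_hit_paths x a : x != e -> paths e a ->
  first_hit x a <-> last e a = x.
Proof.
move=> xe pa; have := covering_path_lt _ _ pa; rewrite lt_path_sortedE.
move=> /andP[/allP ea /lt_sorted_uniq ua].
case/lastP: a pa ea ua => [|b z] _ ea.
  by rewrite /first_hit; split => //= ex; rewrite ex eqxx in xe.
rewrite rcons_uniq last_rcons /first_hit size_rcons eqSS => /andP[zb ub].
rewrite -cats1 index_cat; split => [|<-];
  last by rewrite (negbTE zb) /= eqxx addn0.
case: ifP => [xb /eqP E|_]; first by move: xb; rewrite -index_mem E ltnn.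
by rewrite /=; case: (z =P x) => // _ /eqP; rewrite -{2}[size b]addn0 => /addnI.
Qed.

Lemma paths_to_start : paths_to e e = [set [::]].
Proof.
apply/seteqP; split=> [a [pa]|a ->//].
have := paths_avoid_start _ pa; case/lastP: a pa => // b z _.
by rewrite last_rcons mem_rcons inE => + ze; rewrite ze eqxx.
Qed.

Lemma hit_prob_paths x : (F x)%:E = \esum_(a in paths_to e x) (w a)%:E.
Proof.
rewrite /hit_prob; case: eqP => [->|/eqP xe].
  by rewrite paths_to_start esum_set1 ?path_weight_nil.
rewrite fineK; last first.
  apply: fin_num_measure.
  have := measurable_trajectory mc cS [set a | first_hit x a /\ e \notin a].
  congr measurable; apply/seteqP; split=> v /=.
    move=> [n [hn en]]; apply/hit_time_lt; exists n; split => //.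
    exact/hit_time_gt.
  by move=> /hit_time_lt[n [hn /hit_time_gt en]]; exists n.
rewrite (probability_hit_time_lt mc cS) esum_avoid_start; congr esum.
apply/seteqP; split=> a /=.
  by move=> [ha pa]; split => //; exact/first_hit_paths.
by move=> [pa la]; split => //; exact/first_hit_paths.
Qed.

Lemma survival_paths n : Pr e [set v | (n%:R)%:E < tau e v]
  = \esum_(a in paths_len e n) (w a)%:E.
Proof.
rewrite (probability_hit_time_gt mc cS) esum_avoid_start; congr esum.
by apply/seteqP; split=> a /= [].
Qed.

Lemma hit_prob_ge0 x : (0 <= F x)%R.
Proof. by rewrite -lee_fin hit_prob_paths esum_ge0. Qed.

Lemma hit_prob_start : F e = 1%R.
Proof. by rewrite /hit_prob eqxx. Qed.

Let EF_ge0 x : 0 <= (F x)%:E.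
Proof. by rewrite lee_fin hit_prob_ge0. Qed.
Hint Resolve EF_ge0 : core.

Lemma esum_hit_prob_paths :
  \esum_(x in [set: S]) (F x)%:E = \esum_(a in paths e) (w a)%:E.
Proof.
rewrite (esum_fibers (last e))//.
by apply: eq_esum => x _; exact: hit_prob_paths.
Qed.

(** The paths to [y] are the paths to some [x] covered by [y], followed by [y],
    and [P x y = 0] for all other [x]. *)
Lemma hit_prob_balance y : y != e ->
  \esum_(x in [set: S]) (F x * P x y)%:E = (F y)%:E.
Proof.
move=> ye; have P0 x : 0 <= (P x y)%:E by rewrite lee_fin (transition_ge0 hP).
transitivity (\esum_(a in paths e) ((w a)%:E * (P (last e a) y)%:E)).
  rewrite (esum_fibers (last e)); last by move=> a; rewrite mule_ge0.
  apply: eq_esum => x _; rewrite EFinM muleC hit_prob_paths -esumZl//.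
  by apply: eq_esum => a [_ <-]; rewrite muleC.
rewrite esum_path_weight_rcons hit_prob_paths; apply/esym/esum_support.
  move=> b [pb lb]; case/lastP: b pb lb => [_ /= ey|b z].
    by rewrite ey eqxx in ye.
  rewrite /paths /= last_rcons rcons_path => /andP[pb _] <-.
  by exists b.
move=> _ [a pa <-] npath; rewrite path_weight_rcons.
rewrite transition_eq0 ?mulr0// => ya; apply: npath; split.
  by rewrite /paths /= rcons_path pa /=; exact/asboolP.
by rewrite last_rcons.
Qed.

Lemma hit_prob_gt0 x : (0 < F x)%R.
Proof.
elim/(covering_ind hS): x => [|x y Fx yx]; first by rewrite hit_prob_start.
have [->|ye] := eqVneq y e; first by rewrite hit_prob_start.
rewrite -lte_fin -hit_prob_balance//.
apply: (@lt_le_trans _ _ (F x * P x y)%:E).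
  by rewrite lte_fin mulr_gt0// transition_cover.
rewrite -[leLHS](@esum_delta _ _ x (fun x => (F x * P x y)%:E)).
  apply: le_esum => z _; case: ifP => // _.
  by rewrite lee_fin mulr_ge0 ?hit_prob_ge0 ?(transition_ge0 hP).
by rewrite lee_fin mulr_ge0 ?hit_prob_ge0 ?(transition_ge0 hP).
Qed.

Local Notation mu := (\esum_(x in [set: S]) (F x)%:E).

(** Both [F] and its image under one transition have total mass [mu], as the
    rows of [P] sum to [1]; they agree off [e], so they agree at [e] when the
    common mass is finite. *)
Lemma hit_prob_balance_start : mu < +oo ->
  \esum_(x in [set: S]) (F x * P x e)%:E = (F e)%:E.
Proof.
move=> mu_fin.
have FP0 x y : 0 <= (F x * P x y)%:E.
  by rewrite lee_fin mulr_ge0 ?hit_prob_ge0 ?(transition_ge0 hP).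
pose G y := \esum_(x in [set: S]) (F x * P x y)%:E.
have G0 y : 0 <= G y by exact: esum_ge0.
have total : \esum_(y in [set: S]) G y = mu.
  rewrite /G exchange_esum//; apply: eq_esum => x _.
  under eq_esum do rewrite EFinM.
  rewrite esumZl// ?(transition_sum1 hP) ?mule1// => y.
  by rewrite lee_fin (transition_ge0 hP).
have split_at (g : S -> \bar R) : (forall y, 0 <= g y) ->
    \esum_(y in [set: S]) g y
      = g e + \esum_(y in [set: S]) (if y == e then 0 else g y).
  move=> g0; rewrite -[X in X + _](esum_delta e)// -esumD; last 2 first.
  - by move=> y _; case: ifP.
  - by move=> y _; case: ifP.
  by apply: eq_esum => y _; case: ifP; rewrite ?adde0 ?add0e.
move: total; rewrite (split_at _ G0) (split_at (fun y => (F y)%:E))//.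
have -> : \esum_(y in [set: S]) (if y == e then 0 else G y)
    = \esum_(y in [set: S]) (if y == e then 0 else (F y)%:E).
  by apply: eq_esum => y _; case: ifPn => // ye; exact: hit_prob_balance.
set r := (X in _ + X) => E.
have rfin : r \is a fin_num.
  rewrite ge0_fin_numE; last by apply: esum_ge0 => y _; case: ifP.
  apply: le_lt_trans mu_fin; apply: le_esum => y _; by case: ifP.
by rewrite -[LHS](@addeK _ r)// -/(G e) E addeK.
Qed.

Lemma hit_prob_invariant : mu < +oo ->
  forall y, \esum_(x in [set: S]) (F x * P x y)%:E = (F y)%:E.
Proof.
move=> mu_fin y; have [->|] := eqVneq y e; first exact: hit_prob_balance_start.
exact: hit_prob_balance.
Qed.

(** The tail probability at [n] is the weight of the paths with [n] edges; the
    sum over [n] collects all paths, which are then sorted by endpoint. *)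
Lemma expected_return_start : \int[Pr e]_v tau e v = mu.
Proof.
rewrite (expected_hit_time mc cS) nneseries_esumT//.
rewrite esum_hit_prob_paths (esum_fibers size)//.
by apply: eq_esum => n _; rewrite survival_paths.
Qed.

Lemma positive_recurrentP : positive_recurrent Pr X <-> mu < +oo.
Proof.
split=> [/(_ e)|mu_fin x]; first by rewrite expected_return_start.
exact: (expected_return_lt mc cS F hit_prob_ge0 (hit_prob_invariant mu_fin) x
  (hit_prob_gt0 x) mu_fin).
Qed.

(** The balance equation at [y != e] involves only states strictly below [y], so
    its solutions are determined by their value at [e]: an invariant [f] is
    [f e * F], and normalization gives [f e]. *)
Lemma invariant_densityP : mu < +oo -> forall f : S -> R,
  invariant_density P f <-> (forall x, f x = F x / fine mu)%R.
Proof.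
move=> mu_fin f.
have mu_ge1 : 1 <= mu.
  rewrite -[leLHS]/((1%R)%:E) -hit_prob_start
    -(@esum_delta _ _ e (fun x => (F x)%:E))//.
  by apply: le_esum => y _; case: ifP.
have mu_num : mu \is a fin_num by rewrite ge0_fin_numE// (le_trans _ mu_ge1).
have mu0 : (0 < fine mu)%R.
  by rewrite fine_gt0// mu_fin andbT (lt_le_trans _ mu_ge1).
split=> [[f0 f1 finv] x|fE].
  have fF y : f y = (f e * F y)%R.
    elim/(upward_strong_ind hS): y => y IH.
    have [->|ye] := eqVneq y e; first by rewrite hit_prob_start mulr1.
    apply: EFin_inj; rewrite -finv EFinM -hit_prob_balance// -esumZl//.
    - apply: eq_esum => z _.
      have [yz|nyz] := pselect (covers y z); last first.
        by rewrite transition_eq0// !mulr0 mule0.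
      by rewrite (IH _ (covers_lt _ _ yz)) -mulrA -EFinM.
    - by rewrite lee_fin.
    - by move=> z; rewrite lee_fin mulr_ge0 ?hit_prob_ge0 ?(transition_ge0 hP).
  have : (f e)%:E * mu = 1.
    rewrite -f1 -esumZl//; first by apply: eq_esum => y _; rewrite [in RHS]fF.
    by rewrite lee_fin.
  rewrite -(fineK mu_num) -EFinM => -[E].
  by rewrite [LHS]fF mulrC; congr (_ * _)%R;
    rewrite -[RHS]mul1r -E mulfK// gt_eqF.
have c0 : 0 <= ((fine mu)^-1)%:E by rewrite lee_fin invr_ge0 ltW.
split.
- by move=> x; rewrite fE divr_ge0 ?hit_prob_ge0// ltW.
- under eq_esum => x _ do rewrite fE mulrC EFinM.
  by rewrite esumZl// -(fineK mu_num) -EFinM mulVf// gt_eqF.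
- move=> y; under eq_esum => x _ do rewrite fE mulrAC mulrC EFinM.
  rewrite esumZl// ?hit_prob_invariant// -?EFinM; first by rewrite fE mulrC.
  by move=> x; rewrite lee_fin mulr_ge0 ?hit_prob_ge0 ?(transition_ge0 hP).
Qed.

Lemma ever_start_all : ever e e = 1 ->
  forall x, ever e x = 1.
Proof.
move=> ee; elim/(covering_ind hS) => // x y ex yx.
by case: (ever_prob_reachable mc cS e x y ex (transition_cover _ _ yx)) =>
  [->|].
Qed.

(** For a target [x] the start [e] is the worst starting state, because every
    chain returns to [e] ([le_ever_prob_restart]).  So the average of
    [ever_prob x] over the first step from [e] is its minimum [m], the minimum
    propagates along the covering graph up to [x], and at [x] the value in the
    first-step equation is [1], whence [m = 1]. *)
Lemma recurrent_start : ever e e = 1 -> recurrent Pr X.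
Proof.
move=> ee x; rewrite -/(ever x x).
have le_e y : ever x e <= ever x y.
  have cv : (ever x y + avoid e n y) @[n --> \oo] --> ever x y + 0.
    apply: cvgeD; [|exact: cvg_cst|].
      by apply: fin_num_adde_defr; exact: (ever_prob_fin mc cS).
    have := cvg_avoid_prob mc cS e y.
    by rewrite ever_start_all// subee.
  rewrite -[leRHS]adde0 -(cvg_lim _ cv)//; apply: lime_ge.
    by apply/cvg_ex; eexists; exact: cv.
  by apply: nearW => n; exact: (le_ever_prob_restart mc cS).
pose m := ever x e.
have mfin : m \is a fin_num by exact: (ever_prob_fin mc cS).
have m0 : 0 <= m by exact: measure_ge0.
pose r t := if t == x then 1 else ever x t.
have mr t : m <= r t.
  rewrite /r; case: ifP => _; last exact: le_e.
  exact: (ever_prob_le1 mc cS).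
have [->//|ex] := eqVneq x e.
(* [m] is the value along the covering graph until [x] is met; meeting [x] is
   possible only if [m = 1]. *)
have reach t : m = 1 \/ t <> x /\ ever x t = m.
  elim/(covering_ind hS): t => [|y z [IH|[yx IH]] zy].
  - by right; split => //; apply/eqP; rewrite eq_sym.
  - by left.
  have : r z = m.
    apply: (min_principle P hP y z r m mfin m0 mr _ (transition_cover _ _ zy)).
    by rewrite -IH (ever_probS mc cS).
  by rewrite /r; case: eqP => [_ <-|zx]; [left|right].
case: (reach x) => [m1|[]//]; apply/eqP.
rewrite eq_le -[X in _ && (X <= _)]m1 le_e.
by rewrite (ever_prob_le1 mc cS).
Qed.

Lemma recurrentP : recurrent Pr X <->
  (fun n => \esum_(a in paths_len e n) (w a)%:E) @ \oo --> 0.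
Proof.
have -> : (fun n => \esum_(a in paths_len e n) (w a)%:E)
    = (fun n => avoid e n e).
  by apply/funext => n; rewrite -survival_paths.
have cv := cvg_avoid_prob mc cS e e.
split=> [/(_ e) ee|cv0].
  by rewrite -(@subee R 1)// -{2}ee.
apply: recurrent_start.
have /eqP : 1 - ever e e = 0 by exact: (cvg_unique _ cv cv0).
rewrite sube_eq ?add0e => [/eqP <-//|//|].
by apply: fin_num_adde_defr.
Qed.

End RunChain.

Theorem mainTheorem5 (R : realType) (d : Order.disp_t) (S : porderType d)
    (e : S) (hS : upward_poset e)
    (dO : measure_display) (Omega : measurableType dO)
    (P : S -> S -> R) (Pr : S -> probability Omega R) (X : nat -> Omega -> S)
    (hX : upward_run_chain e P Pr X) :
  let F : S -> R := hit_prob Pr X e in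
  let Fhat : seq S -> R := path_weight P e in
  let mu : \bar R := (\esum_(x in [set: S]) (F x)%:E)%E in
  [/\ forall x : S,
        ((F x)%:E = \esum_(a in paths_to e x) (Fhat a)%:E)%E,
      forall n : nat,
        (Pr e [set w | ((n%:R : R)%:E < hit_time X e w)%E]
          = \esum_(a in paths_len e n) (Fhat a)%:E)%E,
      recurrent Pr X <->
        (fun n : nat => \esum_(a in paths_len e n) (Fhat a)%:E)%E @ \oo --> 0%E
    & (positive_recurrent Pr X <-> (mu < +oo)%E) /\
      ((mu < +oo)%E -> forall f : S -> R,
         invariant_density P f <-> (forall x : S, f x = F x / fine mu))].
Proof.
move=> F Fhat mu; split.
- exact: (hit_prob_paths hS hX).
- exact: (survival_paths hS hX).
- exact: (recurrentP hS hX).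
- split; first exact: (positive_recurrentP hS hX).
  exact: (invariant_densityP hS hX).
Qed.
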